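(* Let $(X,f)$ be a dynamical system satisfying the non-uniform specification property. Then the completely-irregular set $\mathrm{CI}(f)$ contains an uncountable DC1-scrambled set. In particular, for every $\varphi\in C(X)$ with $I_\varphi(f)\neq\varnothing$, the $\varphi$-irregular set $I_\varphi(f)$ contains an uncountable DC1-scrambled set.
   Context: A dynamical system $(X,f)$ consists of a compact metric space $(X,d)$ with at least two points and a continuous map $f:X\to X$. $\mathbb{N}$ denotes the positive integers. $C(X)$ is the space of real-valued continuous functions on $X$. Non-uniform specification property: $(X,f)$ satisfies the non-uniform specification property with gap function $M(n,\varepsilon):\mathbb{N}\times(0,+\infty)\to\mathbb{N}$ if (i) $M(n,\varepsilon)$ is non-decreasing in $n$ and non-increasing in $\varepsilon$; (ii) for every $\varepsilon>0$, any integer $k\ge2$, any $x_1,\dots,x_k\in X$ and any non-negative integers $a_1\le b_1<a_2\le b_2<\cdots<a_k\le b_k$ with $a_{i+1}-b_i\ge M(b_i-a_i+1,\varepsilon)$ for $1\le i\le k-1$, there exists $z\in X$ such that $d(f^{n-a_i}x_i,f^nz)\le\varepsilon$ for all $a_i\le n\le b_i$ and $1\le i\le k$. $(X,f)$ satisfies the non-uniform specification property if it does so with some gap function. For $\varphi\in C(X)$, the $\varphi$-irregular set is $I_\varphi(f)=\{x\in X:\lim_{n\to\infty}\frac1n\sum_{k=0}^{n-1}\varphi(f^kx)\text{ does not exist}\}$. Let $\mathfrak{C}(f)=\{\varphi\in C(X):I_\varphi(f)\neq\varnothing\}$ and $\mathrm{CI}(f)=\bigcap_{\varphi\in\mathfrak{C}(f)}I_\varphi(f)$.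 A pair $\{x,y\}$ is DC1-scrambled if for every $t>0$, $\limsup_{n\to\infty}\frac1n|\{j\in[0,n-1]:d(f^jx,f^jy)<t\}|=1$, and there exists $t_0>0$ such that $\liminf_{n\to\infty}\frac1n|\{j\in[0,n-1]:d(f^jx,f^jy)<t_0\}|=0$ (here $j$ ranges over integers). A set $S\subset X$ is DC1-scrambled if each pair of distinct points of $S$ is DC1-scrambled. *)

(* Defs.v *)
From HB Require Import structures.
From mathcomp Require Export all_boot all_order all_algebra.
From mathcomp Require Export all_classical all_reals all_analysis.

Set Implicit Arguments.
Unset Strict Implicit.
Unset Printing Implicit Defensive.

Import Order.TTheory GRing.Theory Num.Theory.
Import numFieldNormedType.Exports.

Local Open Scope classical_set_scope.
Local Open Scope ring_scope.

(* A gap function has type N x (0, +oo) -> N with N the positive integers;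
   its values at n = 0 or eps <= 0 are left unconstrained and never used. *)
Definition gap_function (R : realType) (M : nat -> R -> nat) : Prop :=
  [/\ forall n eps, (0 < n)%N -> 0 < eps -> (0 < M n eps)%N,
      forall m n eps, (0 < m)%N -> (m <= n)%N -> 0 < eps ->
        (M m eps <= M n eps)%N
    & forall n eps eps', (0 < n)%N -> 0 < eps -> eps <= eps' ->
        (M n eps' <= M n eps)%N].

(* The k orbit segments are indexed by i = 0, ..., k - 1; the values of
   x, a, b at indices i >= k play no role. *)
Definition nonuniform_specification_with (R : realType) (X : metricType R)
    (f : X -> X) (M : nat -> R -> nat) : Prop :=
  gap_function M /\
  forall (eps : R) (k : nat) (x : nat -> X) (a b : nat -> nat),
    0 < eps -> (2 <= k)%N ->
    (forall i, (i < k)%N -> (a i <= b i)%N) ->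
    (forall i, (i.+1 < k)%N -> (b i < a i.+1)%N) ->
    (forall i, (i.+1 < k)%N -> (M (b i - a i + 1)%N eps <= a i.+1 - b i)%N) ->
    exists z : X, forall i n, (i < k)%N -> (a i <= n <= b i)%N ->
      mdist (iter (n - a i) f (x i)) (iter n f z) <= eps.

Definition nonuniform_specification (R : realType) (X : metricType R)
    (f : X -> X) : Prop :=
  exists M : nat -> R -> nat, nonuniform_specification_with f M.

(* [arithmetic_mean u n] is the mean of u 0, ..., u n, so the sequence of
   Birkhoff averages below starts with the average of length 1. *)
Definition irregular_set (R : realType) (X : metricType R)
    (f : X -> X) (phi : X -> R) : set X :=
  [set x | ~ cvgn (arithmetic_mean (fun k => phi (iter k f x)))].

Definition irregular_observables (R : realType) (X : metricType R)
    (f : X -> X) : set (X -> R) :=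
  [set phi | continuous phi /\ irregular_set f phi !=set0].

(* This is the whole space when [irregular_observables f] is empty. *)
Definition completely_irregular_set (R : realType) (X : metricType R)
    (f : X -> X) : set X :=
  \bigcap_(phi in irregular_observables f) irregular_set f phi.

(* The n-th term is the proportion of times j in [0, n] (n + 1 times in all)
   at which the orbits of x and y are t-close. *)
Definition closeness_frequency (R : realType) (X : metricType R)
    (f : X -> X) (x y : X) (t : R) : R^nat :=
  fun n => (#|[pred j : 'I_n.+1 | mdist (iter j f x) (iter j f y) < t]|)%:R
           / n.+1%:R.

Definition DC1_scrambled_pair (R : realType) (X : metricType R)
    (f : X -> X) (x y : X) : Prop :=
  (forall t : R, 0 < t -> limn_sup (closeness_frequency f x y t) = 1) /\
  (exists2 t0 : R, 0 < t0 & limn_inf (closeness_frequency f x y t0) = 0).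

Definition DC1_scrambled (R : realType) (X : metricType R)
    (f : X -> X) (S : set X) : Prop :=
  forall x y, S x -> S y -> x <> y -> DC1_scrambled_pair f x y.

(* Main.v *)
(* Since the gap required after an orbit segment depends only on the past, a
   shadowing segment may be taken so long that it dominates the Birkhoff averages
   at its last time; gaps of arbitrary size are then harmless, and letting the
   error tend to 0 along the steps gives a point z_w for each 0-1 sequence w.
   The segments are of two kinds. Steps attached to a bit k follow one of two
   orbits that stay a fixed distance apart, according to w k: this separates
   z_w from z_w' during almost all of arbitrarily long initial time windows. The
   other steps do not depend on w, so they bring z_w and z_w' together. They treat all observables
   at once: at each precision, the visit frequencies of orbit segments take
   finitely many rounded values, independently of the length, and every value
   realized by arbitrarily long segments is followed. If some phi-average
   oscillates along an orbit, two such values already witness the oscillation,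
   and z_w inherits it. *)
Require Import Defs.
From mathcomp Require Import all_boot all_order all_algebra.
From mathcomp Require Import all_classical all_reals all_analysis.
From mathcomp Require Import ring lra zify.
Import Order.TTheory GRing.Theory Num.Theory.
Import numFieldNormedType.Exports.

Set Implicit Arguments.
Unset Strict Implicit.
Unset Printing Implicit Defensive.

Local Open Scope classical_set_scope.
Local Open Scope ring_scope.

(** * Compactness: uniform continuity, finite nets, cluster points *)

Lemma compact_uniformly_continuous (R : realType) (X Y : pseudoMetricType R)
    (g : X -> Y) : compact [set: X] -> continuous g ->
  forall e : R, 0 < e ->
    exists2 d : R, 0 < d & forall u v, ball u d v -> ball (g u) e (g v).
Proof.
move=> /compact_near_coveringP cX cg e e0.
pose P (d : R) (u : X) := forall v, ball u d v -> ball (g u) e (g v).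
have /cX : forall x : X, [set: X] x ->
    \forall x' \near x & d \near (0 : R)^'+, P d x'.
  move=> x _.
  have /nbhs_ballP[r /= r0 xr] : \forall y \near x, ball (g x) (e / 2) (g y).
    by apply: cg; apply: nbhsx_ballx; rewrite divr_gt0.
  exists (ball x (r / 2), [set d : R | d < r / 2]) => /=.
    by split; [apply: nbhsx_ballx | apply: nbhs_right_lt]; rewrite divr_gt0.
  move=> [x' d] /= [xx' dr] v x'v; apply: (@ball_splitr _ _ (g x)).
    by apply: xr; apply: le_ball xx'; lra.
  by apply: xr; apply: (le_ball _ (ball_triangle xx' x'v)); lra.
move=> H.
have [d [d0 Pd]] : exists d : R, 0 < d /\ [set: X] `<=` P d.
  apply: (@filter_ex _ ((0 : R)^'+)).
  by near=> d; split; [near: d; apply: nbhs_right_gt | near: d; apply: H].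
by exists d => // u v; apply: Pd.
Unshelve. all: by end_near. Qed.

Lemma compact_net (R : realType) (X : pseudoMetricType R) (d : R) :
  compact [set: X] -> 0 < d ->
  exists (n : nat) (c : 'I_n -> X), forall x, exists i, ball (c i) d x.
Proof.
move=> /compact_near_coveringP cX d0.
(* Finite lists of centres are directed by inclusion. A list eventually contains any given centre,
   so compactness yields one list that serves all points. *)
pose F := filter_from [set: seq X] (fun s => [set t : seq X | {subset s <= t}]).
have FF : Filter F.
  apply: filter_from_filter; first by exists [::].
  move=> s t _ _; exists (s ++ t) => // r str; split=> x xs; apply: str;
    by rewrite mem_cat xs ?orbT.
have [|s _ /(_ s (fun=> id)) sX] :=
    cX _ F (fun s x => exists2 c, c \in s & ball c d x) FF.
  move=> x _; exists (ball x d, [set s : seq X | x \in s]) => /=.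
    split; first exact: nbhsx_ballx.
    by exists [:: x] => // s /(_ x); apply; rewrite mem_head.
  by move=> [y s] /= [xy xs]; exists x.
exists (size s), (tnth (in_tuple s)) => x.
have [c /(tnthP (in_tuple s))[i ->] cx] := sX x I.
by exists i.
Qed.

Lemma compact_bounded_fun (R : realType) (X : topologicalType) (phi : X -> R) :
  compact [set: X] -> continuous phi ->
  exists2 K : R, 0 < K & forall x, `|phi x| <= K.
Proof.
move=> cX cphi.
have /compact_bounded : compact (phi @` setT).
  by apply: continuous_compact => //; apply: continuous_subspaceT.
move=> [M [_ /(_ (`|M| + 1)) MP]].
exists (`|M| + 1) => [|x]; first by rewrite ltr_wpDl.
by apply: MP; [rewrite (le_lt_trans (ler_norm M))// ltrDl | exists x].
Qed.

Lemma ball_mdist (R : realType) (X : metricType R) (x y : X) (d : R) :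
  ball x d y = (mdist x y < d) :> Prop.
Proof. by rewrite ballEmdist. Qed.

Lemma ball_real (R : realType) (x y d : R) :
  ball x d y = (`|x - y| < d) :> Prop.
Proof. by rewrite -ball_normE. Qed.

(** Stands in for a convergent subsequence: only closed conditions that hold along a tail have to
    pass to the limit. *)
Lemma compact_seq_cluster (X : topologicalType) (u : nat -> X) :
  compact [set: X] -> exists z, forall (C : set X) N, closed C ->
    (forall n, (N <= n)%N -> C (u n)) -> C z.
Proof.
move=> cX; have [|z [_ zu]] := cX (u @ \oo) _ ; first exact: filterT.
exists z => C N cC uC.
apply: cC => B zB; have [] := zu C B _ zB; last by move=> w; exists w.
by exists N => // n /= /uC.
Qed.

Lemma iter_continuous (X : topologicalType) (f : X -> X) n :
  continuous f -> continuous (iter n f).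
Proof.
move=> cf; elim: n => [|n IH] x; first exact: cvg_id.
by apply: (continuous_comp (IH x)); apply: cf.
Qed.

Lemma closed_mdist_le (R : realType) (X : metricType R) (g : X -> X) (y : X) e :
  continuous g -> closed [set w | mdist y (g w) <= e].
Proof.
move=> cg; rewrite -[X in closed X]setCK; apply: open_closedC.
rewrite openE => w /= /negP; rewrite -ltNge => yw.
have d0 : 0 < mdist y (g w) - e by rewrite subr_gt0.
have : \forall v \near w, ball (g w) (mdist y (g w) - e) (g v).
  by apply: cg; apply: nbhsx_ballx.
apply: filterS => v; rewrite ball_mdist => wv; apply/negP; rewrite -ltNge.
have := metric_triangle y (g v) (g w); rewrite (metric_sym (g v)); lra.
Qed.

(** * Shadowing infinitely many orbit segments *)

(** The gap is governed by the length of the first segment alone, so the second may be arbitrarily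
    long. *)
Lemma spec_glue (R : realType) (X : metricType R) (f : X -> X)
    (M : nat -> R -> nat) (eps : R) (u x : X) (b a L : nat) :
  nonuniform_specification_with f M -> 0 < eps ->
  (b + M b.+1 eps <= a)%N ->
  exists z, (forall n, (n <= b)%N -> mdist (iter n f u) (iter n f z) <= eps) /\
    (forall k, (k <= L)%N -> mdist (iter k f x) (iter (a + k) f z) <= eps).
Proof.
move=> [[Mpos _ _] spec] eps0 ba.
have M0 := Mpos b.+1 eps (ltn0Sn _) eps0.
have [|||z zP] := spec eps 2 (fun i => if i == 0 then u else x)
  (fun i => if i == 0 then 0 else a) (fun i => if i == 0 then b else a + L)%N
  eps0 (leqnn 2).
- by case=> [|i] _ //=; rewrite leq_addr.
- by case=> [|i] //= _; lia.
- by case=> [|i] //= _; rewrite subn0 addn1; lia.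
exists z; split=> [n nb|k kL].
  by have := zP 0 n isT; rewrite /= subn0; apply.
have := zP 1 (a + k)%N isT; rewrite /= addKn; apply.
by rewrite leq_addr leq_add2l.
Qed.

(* Only gluing of two segments is used: Z (i + 1) follows Z i on [0, a i + L i]
   with error 2^-(i+1), so the successive errors are summable. *)
Lemma spec_shadow (R : realType) (X : metricType R) (f : X -> X)
    (M : nat -> R -> nat) (x : nat -> X) (a L : nat -> nat) :
  compact [set: X] -> continuous f -> nonuniform_specification_with f M ->
  a 0 = 0 ->
  (forall i, a i + L i + M (a i + L i).+1 (2 ^- i.+1) <= a i.+1)%N ->
  exists z, forall i k, (k <= L i)%N ->
    mdist (iter k f (x i)) (iter (a i + k) f z) <= 2 * 2 ^- i.
Proof.
move=> cX cf spec a0 aL.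
have e0 i : 0 < 2 ^- i :> R by rewrite invr_gt0 exprn_gt0.
have glue i u : exists z,
    (forall n, (n <= a i + L i)%N ->
       mdist (iter n f u) (iter n f z) <= 2 ^- i.+1) /\
    (forall k, (k <= L i.+1)%N ->
       mdist (iter k f (x i.+1)) (iter (a i.+1 + k) f z) <= 2 ^- i.+1).
  exact: (spec_glue _ _ _ spec (e0 i.+1) (aL i)).
have {glue} [g gP] := choice (fun p : nat * X => glue p.1 p.2).
pose Z := fix Z i := if i is j.+1 then g (j, Z j) else x 0.
have Zx i k : (k <= L i)%N ->
    mdist (iter k f (x i)) (iter (a i + k) f (Z i)) <= 2 ^- i.
  case: i => [|i] kL; first by rewrite a0 add0n mdistxx ltW.
  by have [_] := gP (i, Z i); apply.
have amono i j : (i <= j)%N -> (a i + L i <= a j + L j)%N.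
  elim: j => [|j IH]; first by rewrite leqn0 => /eqP ->.
  rewrite leq_eqVlt => /orP[/eqP -> //|/IH]; have := aL j; lia.
(* The errors [2 ^- l.+1] for i <= l < j sum to [2 ^- i - 2 ^- j]. *)
have ZZ i j n : (n <= a i + L i)%N -> (i <= j)%N ->
    mdist (iter n f (Z i)) (iter n f (Z j)) <= 2 ^- i - 2 ^- j.
  move=> ni; elim: j => [|j IH].
    by rewrite leqn0 => /eqP ->; rewrite mdistxx subrr.
  rewrite leq_eqVlt => /orP[/eqP ->|ij]; first by rewrite mdistxx subrr.
  have [/(_ n (leq_trans ni (amono i j ij))) /= H _] := gP (j, Z j).
  have := IH ij.
  have := metric_triangle (iter n f (Z i)) (iter n f (Z j)) (iter n f (Z j.+1)).
  have -> : 2 ^- j = 2 * 2 ^- j.+1 :> R by rewrite exprS; field.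
  rewrite /=; lra.
have [z zP] := compact_seq_cluster Z cX.
exists z => i k kL.
(* Every [Z j] with j >= i satisfies this closed condition, hence so does the cluster point [z];
   [Zx] adds a second [2 ^- i]. *)
have : mdist (iter (a i + k) f (Z i)) (iter (a i + k) f z) <= 2 ^- i.
  apply: (zP [set w | mdist (iter (a i + k) f (Z i)) (iter (a i + k) f w) <= 2 ^- i] i).
    by apply: closed_mdist_le; apply: iter_continuous.
  move=> j ij /=; have := e0 j.
  have := @ZZ i j (a i + k)%N; rewrite leq_add2l => /(_ kL ij).
  lra.
have := Zx _ _ kL.
have := metric_triangle (iter k f (x i)) (iter (a i + k) f (Z i)) (iter (a i + k) f z).
lra.
Qed.

(** * Pairs of orbits that stay apart *)

Lemma iter_equicontinuous (R : realType) (X : metricType R) (f : X -> X)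
    (M : nat) (e : R) : compact [set: X] -> continuous f -> 0 < e ->
  exists2 d : R, 0 < d & forall s u v, (s <= M)%N -> mdist u v < d ->
    mdist (iter s f u) (iter s f v) < e.
Proof.
move=> cX cf e0; elim: M => [|M [d d0 dP]].
  by exists e => // s u v; rewrite leqn0 => /eqP ->.
have [d' d'0 d'P] :=
  compact_uniformly_continuous cX (iter_continuous (n := M.+1) cf) e0.
exists (Num.min d d') => [|s u v]; first by rewrite lt_min d0.
rewrite leq_eqVlt lt_min => /orP[/eqP ->|sM] /andP[ud ud']; last exact: dP.
by rewrite -ball_mdist; apply: d'P; rewrite ball_mdist.
Qed.

(* Choose p and q whose orbits return near x, respectively y, at all multiples
   of m := M(1, eps). Were the orbits close at some time j, equicontinuity of
   f^0, ..., f^m would make them close at the next multiple of m. *)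
Lemma spec_distal (R : realType) (X : metricType R) (f : X -> X) :
  compact [set: X] -> (exists x y : X, x <> y) -> continuous f ->
  nonuniform_specification f ->
  exists2 t : R, 0 < t & forall L, exists p q : X, forall j, (j <= L)%N ->
    t <= mdist (iter j f p) (iter j f q).
Proof.
move=> cX [x [y /eqP xy]] cf [M [[Mpos _ _] spec]].
have d0 : 0 < mdist x y by rewrite mdist_gt0.
(* One [e] for the return near x, one for the return near y and one for equicontinuity: 3e is less
   than d(x, y). *)
pose e := mdist x y / 4.
have e0 : 0 < e by rewrite divr_gt0.
pose m := M 1%N e; have m0 : (0 < m)%N by apply: Mpos.
(* The segments are single points, so the same gap [M 1 e] suffices after each of them. There are
   [L.+2] of them because specification asks for at least two. *)
have recur w L : exists z, forall i, (i <= L)%N -> mdist w (iter (i * m) f z) <= e.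
  have [//|i iL|i iL|z zP] :=
    spec e L.+2 (fun=> w) (fun i => i * m)%N (fun i => i * m)%N e0 isT.
  - by rewrite ltn_mul2r m0 /=.
  - by rewrite subnn mulSn addnK.
  by exists z => i iL; have := zP i (i * m)%N; rewrite subnn leqnn; apply => //; lia.
have [t t0 tP] := iter_equicontinuous m cX cf e0.
exists t => // L.
have [p pP] := recur x L.+1; have [q qP] := recur y L.+1.
exists p, q => j jL; rewrite leNgt; apply/negP => pq.
(* [i * m] is the first multiple of m strictly after j, at most m steps later. It may lie beyond L,
   but i <= L + 1, which is why returns were requested up to [L.+1]. *)
pose i := (j %/ m).+1; pose s := (i * m - j)%N.
have jm := divn_eq j m; have jltm := ltn_pmod j m0.
have im : (i * m = m + j %/ m * m)%N by rewrite mulSn.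
have js : (s + j = i * m)%N by rewrite /s; lia.
have sm : (s <= m)%N by rewrite /s; lia.
have iL : (i <= L.+1)%N by rewrite /i ltnS (leq_trans (leq_div _ _)).
have := tP s _ _ sm pq; rewrite -!iterD js.
have := pP i iL; have := qP i iL.
have := metric_triangle x (iter (i * m) f p) y.
have := metric_triangle (iter (i * m) f p) (iter (i * m) f q) y.
rewrite (metric_sym (iter (i * m) f q)) /e; lra.
Qed.

(** * Birkhoff averages and finite codes of orbit segments *)

Lemma infinite_pigeonhole (T : finType) (u : nat -> T) :
  exists v, forall N, exists2 n, (N <= n)%N & u n = v.
Proof.
apply: contrapT => /forallNP H.
have {H} [N NP] : {N : T -> nat & forall v n, (N v <= n)%N -> u n <> v}.
  apply: (choice (P := fun v N => forall n, (N <= n)%N -> u n <> v)) => v.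
  have /existsNP[N NP] := H v; exists N => n Nn unv.
  by apply: NP; exists n.
pose n := (\max_v N v)%N.
by apply: (NP (u n) n) => //; apply: leq_bigmax.
Qed.

Lemma arithmetic_meanE (R : realType) (u : R^nat) n :
  arithmetic_mean u n = (\sum_(0 <= k < n.+1) u k) / n.+1%:R.
Proof. by rewrite /arithmetic_mean /= mulrC. Qed.

Lemma sum_norm_le (R : realType) (u : R^nat) n (K : R) :
  (forall k, (k < n)%N -> `|u k| <= K) -> `|\sum_(0 <= k < n) u k| <= K * n%:R.
Proof.
move=> uK; rewrite big_mkord (le_trans (ler_norm_sum _ _ _))//.
apply: (@le_trans _ _ (\sum_(i < n) K)).
  by apply: ler_sum => i _; apply: uK.
by rewrite sumr_const card_ord mulr_natr.
Qed.

(** The first a terms cost twice, once by their own values and once by diluting the average of v;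
    each effect is at most K a / (a + L + 1). *)
Lemma arithmetic_mean_shift (R : realType) (u v : R^nat) a L (K eta : R) :
  (forall n, `|u n| <= K) -> (forall n, `|v n| <= K) ->
  (forall k, (k <= L)%N -> `|v k - u (a + k)%N| <= eta) ->
  `|arithmetic_mean u (a + L) - arithmetic_mean v L|
    <= eta + 2 * K * (a%:R / (a + L).+1%:R).
Proof.
move=> uK vK uv; rewrite !arithmetic_meanE.
rewrite (@big_cat_nat _ _ _ a) //= ?leqW ?leq_addr//.
have -> : \sum_(a <= i < (a + L).+1) u i = \sum_(0 <= i < L.+1) u (i + a)%N.
  by rewrite -{1}(add0n a) big_addn -addnS addKn.
set U := \sum_(0 <= i < a) _; set W := \sum_(0 <= i < L.+1) u _.
set V := \sum_(0 <= i < L.+1) v _.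
have UP : `|U| <= K * a%:R by apply: sum_norm_le.
have VP : `|V| <= K * L.+1%:R by apply: sum_norm_le.
have WV : `|W - V| <= eta * L.+1%:R.
  by rewrite -sumrB; apply: sum_norm_le => k kL; rewrite distrC addnC; apply: uv.
rewrite -addnS natrD; set A := a%:R in UP *; set B := L.+1%:R in VP WV *.
have A0 : 0 <= A by rewrite ler0n.
have B0 : 0 < B by rewrite ltr0n.
have AB0 : 0 < A + B by rewrite ltr_wpDl.
have -> : (U + W) / (A + B) - V / B = (U + (W - V) - A * (V / B)) / (A + B).
  by field; rewrite !gt_eqF.
have VB : `|V / B| <= K by rewrite normrM normfV (gtr0_norm B0) ler_pdivrMr.
have K0 : 0 <= K by apply: le_trans (normr_ge0 _) (uK 0).
have eta0 : 0 <= eta by apply: le_trans (normr_ge0 _) (uv 0 isT).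
rewrite normrM normfV (gtr0_norm AB0) ler_pdivrMr// mulrDl -!mulrA mulVf ?gt_eqF//.
have := ler_normB (U + (W - V)) (A * (V / B)).
have := ler_normD U (W - V).
have : `|A * (V / B)| <= A * K by rewrite normrM (ger0_norm A0) ler_wpM2l.
have : 0 <= eta * A by rewrite mulr_ge0.
nra.
Qed.

Lemma arithmetic_mean_dist (R : realType) (u v : R^nat) n (K eta : R) :
  (forall n, `|u n| <= K) -> (forall n, `|v n| <= K) ->
  (forall k, `|v k - u k| <= eta) ->
  `|arithmetic_mean u n - arithmetic_mean v n| <= eta.
Proof.
move=> uK vK uv; have := @arithmetic_mean_shift _ u v 0 n K eta uK vK.
by rewrite mul0r mulr0 addr0; apply.
Qed.

(* Partition X into p pieces of small diameter. The code q x n records, up to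
   1 / N, the proportions of time that the orbit segment of length n + 1 spends
   in each piece, so Q does not depend on n. *)
Lemma orbit_quantization_at (R : realType) (X : metricType R) (f : X -> X) (d : R) :
  compact [set: X] -> 0 < d ->
  exists (Q : nat) (q : X -> nat -> nat), (forall x n, (q x n < Q)%N) /\
    forall (phi : X -> R) (K eta : R), (forall x, `|phi x| <= K) ->
      (forall u v, mdist u v < d -> `|phi u - phi v| <= eta) ->
      forall x y n l, q x n = q y l ->
      `|arithmetic_mean (fun k => phi (iter k f x)) n
        - arithmetic_mean (fun k => phi (iter k f y)) l| <= 2 * eta + K * d.
Proof.
move=> cX d0; have [p [c cP]] := compact_net cX d0.
have {cP} [h hP] := choice cP.
(* The p rounding errors, 1/N each, must add up to at most d. *)
pose N := (Num.truncn (p%:R / d)).+1.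
have N0 : 0 < N%:R :> R by rewrite ltr0n.
have pN : p%:R / N%:R <= d.
  rewrite ler_pdivrMr// mulrC -ler_pdivrMr//.
  by rewrite ltW// /N truncnS_gt.
pose freq (x : X) (n : nat) (i : 'I_p) : R :=
  arithmetic_mean (fun k => (h (iter k f x) == i)%:R) n.
have freq0 x n i : 0 <= freq x n i.
  by rewrite /freq arithmetic_meanE divr_ge0// sumr_ge0.
have freq1 x n i : freq x n i <= 1.
  rewrite /freq arithmetic_meanE ler_pdivrMr ?ltr0n// mul1r.
  apply: le_trans (ler_norm _) _; rewrite -[leRHS]mul1r.
  by apply: sum_norm_le => k _; case: eqP; rewrite ?normr1 ?normr0.
(* [inord] never falls back to its default: frequencies are at most 1, so the rounded values are at
   most N. *)
pose vec x n : {ffun 'I_p -> 'I_N.+1} :=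
  [ffun i => inord (Num.truncn (freq x n i * N%:R))].
exists #|{: {ffun 'I_p -> 'I_N.+1}}|, (fun x n => nat_of_ord (enum_rank (vec x n))).
split=> [x n|phi K eta phiK phid x y n l /ord_inj/enum_rank_inj xy].
  exact: ltn_ord.
(* The average of phi with each value replaced by the one at the centre of its piece, written
   through the frequencies. *)
pose s x n := \sum_i phi (c i) * freq x n i.
have means x' n' : `|arithmetic_mean (fun k => phi (iter k f x')) n' - s x' n'| <= eta.
  have -> : s x' n' = arithmetic_mean (fun k => phi (c (h (iter k f x')))) n'.
    rewrite arithmetic_meanE big_mkord mulr_suml /s /freq.
    under eq_bigr => i _.
      rewrite arithmetic_meanE big_mkord mulrA mulr_sumr mulr_suml; over.
    rewrite exchange_big; apply: eq_bigr => k _ /=.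
    rewrite (bigD1 (h (iter k f x'))) //= eqxx mulr1 big1 ?addr0// => i /negbTE ih.
    by rewrite eq_sym ih mulr0 mul0r.
  apply: (@arithmetic_mean_dist _ _ _ _ K) => // k.
  by apply: phid; rewrite -ball_mdist.
have freqs i : `|freq x n i - freq y l i| <= N%:R^-1.
  have /(congr1 (@nat_of_ord _)) := congr1 (fun v : {ffun _} => v i) xy.
  have tN x' n' : (Num.truncn (freq x' n' i * N%:R) < N.+1)%N.
    rewrite ltnS truncn_le_nat (@le_lt_trans _ _ N%:R)//; last by rewrite ltr_nat.
    by rewrite ler_piMl.
  rewrite !ffunE !inordK// => xyi.
  rewrite -(ler_pM2r N0) mulVf ?gt_eqF// -(gtr0_norm N0) -normrM mulrBl.
  have := truncn_itv (mulr_ge0 (freq0 x n i) (ltW N0)).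
  have := truncn_itv (mulr_ge0 (freq0 y l i) (ltW N0)).
  by rewrite xyi ler_distl -natr1 => /andP[? ?] /andP[? ?]; apply/andP; split; lra.
have ss : `|s x n - s y l| <= K * d.
  have K0 : 0 <= K by apply: le_trans (normr_ge0 _) (phiK x).
  rewrite /s -sumrB (le_trans (ler_norm_sum _ _ _))//.
  apply: (@le_trans _ _ (\sum_(i < p) K * N%:R^-1)).
    by apply: ler_sum => i _; rewrite -mulrBr normrM ler_pM.
  by rewrite sumr_const card_ord -[leLHS]mulr_natr -mulrA ler_wpM2l// mulrC.
have := ler_distD (s x n) (arithmetic_mean (fun k => phi (iter k f x)) n) (s y l).
have := ler_distD (s y l) (arithmetic_mean (fun k => phi (iter k f x)) n)
   (arithmetic_mean (fun k => phi (iter k f y)) l).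
have := means x n; have := means y l.
rewrite (distrC (s y l)); lra.
Qed.

(** One countable family of codes, fixed before phi, serves all observables; this is what lets a
    single point be irregular for all of them. *)
Lemma orbit_quantization (R : realType) (X : metricType R) (f : X -> X) :
  compact [set: X] ->
  exists (Q : nat -> nat) (q : nat -> X -> nat -> nat),
    (forall m x n, (q m x n < Q m)%N) /\
    forall (phi : X -> R) (e : R), continuous phi -> 0 < e ->
      exists m, forall x y n l, q m x n = q m y l ->
      `|arithmetic_mean (fun k => phi (iter k f x)) n
        - arithmetic_mean (fun k => phi (iter k f y)) l| <= e.
Proof.
move=> cX.
have d0 m : 0 < m.+1%:R^-1 :> R by rewrite invr_gt0 ltr0n.
have [Q QP] := choice (fun m => orbit_quantization_at f cX (d0 m)).
have {QP} [q qP] := choice QP.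
exists Q, q; split=> [m|phi e cphi e0]; first by have [] := qP m.
have [K K0 phiK] := compact_bounded_fun cX cphi.
have [d dgt0 dP] := compact_uniformly_continuous cX cphi (divr_gt0 e0 (ltr0Sn R 3)).
(* At scale 1/(m+1), phi varies by at most e/4 and K/(m+1) <= e/2, so the total error is 2(e/4) +
   e/2 = e. *)
pose m := Num.truncn (Num.max (d^-1) (K / (e / 2))).
have : Num.max (d^-1) (K / (e / 2)) < m.+1%:R by rewrite /m truncnS_gt.
rewrite gt_max => /andP[md mK].
have m0 : 0 < m.+1%:R :> R by rewrite ltr0n.
have mdd : m.+1%:R^-1 < d by rewrite -[d]invrK ltf_pV2// posrE invr_gt0.
have mKe : K * m.+1%:R^-1 <= e / 2.
  by rewrite ler_pdivrMr// mulrC -ler_pdivrMr ?divr_gt0// ltW.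
exists m => x y n l xy.
have [_ /(_ phi K (e / 4) phiK) H] := qP m.
have phi_m u v : mdist u v < m.+1%:R^-1 -> `|phi u - phi v| <= e / 4.
  move=> uv; rewrite ltW// -ball_real; apply: dP; rewrite ball_mdist.
  exact: lt_trans mdd.
apply: (le_trans (H phi_m _ _ _ _ xy)).
by move: (K / _) mKe => Km ?; lra.
Qed.

(** * Limits of sequences, Cantor's diagonal, closeness frequencies *)

Lemma limn_sup_eq1 (R : realType) (u : R^nat) :
  (forall n, u n <= 1) ->
  (forall e N, 0 < e -> exists2 n, (N <= n)%N & 1 - e <= u n) ->
  limn_sup u = 1.
Proof.
move=> u1 uN; rewrite /limn_sup (_ : sups u = fun=> 1); first exact: lim_cst.
apply/funext => n; apply/eqP; rewrite eq_le; apply/andP; split.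
  by apply: ge_sup; [exists (u n), n => /= | move=> _ [k _ <-]].
apply/ler_addgt0Pr => e e0; have [k nk uk] := uN e n e0.
rewrite -lerBlDr (le_trans uk)//; apply: ub_le_sup; last by exists k.
by exists 1 => _ [j _ <-].
Qed.

Lemma limn_inf_eq0 (R : realType) (u : R^nat) :
  (forall n, 0 <= u n) ->
  (forall e N, 0 < e -> exists2 n, (N <= n)%N & u n <= e) ->
  limn_inf u = 0.
Proof.
move=> u0 uN; rewrite /limn_inf (_ : infs u = fun=> 0); first exact: lim_cst.
apply/funext => n; apply/eqP; rewrite eq_le; apply/andP; split; last first.
  by apply: lb_le_inf; [exists (u n), n => /= | move=> _ [k _ <-]].
apply/ler_addgt0Pr => e e0; have [k nk uk] := uN e n e0.
rewrite add0r (le_trans _ uk)//; apply: ge_inf; last by exists k.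
by exists 0 => _ [j _ <-].
Qed.

Lemma not_cvgnP (R : realType) (u : R^nat) : ~ cvgn u <->
  exists2 e : R, 0 < e & forall N, exists n m,
    [/\ (N <= n)%N, (N <= m)%N & e <= `|u n - u m|].
Proof.
split=> [ncvg|[e e0 uN] cu].
  apply: contrapT => H; apply: ncvg; apply/cauchy_cvgP/cauchyP => e e0.
  have [N NP] : exists N, forall n m, (N <= n)%N -> (N <= m)%N -> `|u n - u m| < e.
    apply: contrapT => /forallNP H'; apply: H; exists e => // N.
    have /existsNP[n /existsNP[m /not_implyP[Nn /not_implyP[Nm /negP]]]] := H' N.
    by rewrite -leNgt => ?; exists n, m.
  by exists (u N), N => // n /= Nn; rewrite ball_real; apply: NP.
have /cvgrPdist_lt/(_ _ (divr_gt0 e0 (ltr0Sn R 1))) [N _ NP] := cu.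
have [n [m [/NP /= un /NP /= um]]] := uN N; apply/negP; rewrite -ltNge.
by have := ler_distD (limn u) (u n) (u m); rewrite distrC in un; lra.
Qed.

Lemma uncountable_range_cantor (X : Type) (Z : (nat -> bool) -> X) :
  injective Z -> ~ countable (range Z).
Proof.
move=> injZ /countable_injP[g injg].
(* The diagonal sequence: at n it differs from the sequence whose image has number n, if there is
   one. Taking n to be the number of [Z w] is contradictory. *)
pose w n := ~~ `[< exists w', g (Z w') = n /\ w' n >].
have gZ w' : g (Z w') = g (Z w) -> w' = w.
  by move=> /injg H; apply: injZ; apply: H; rewrite inE; [exists w' | exists w].
case wE: (w (g (Z w))).
  by move: (wE) => /negP; apply; apply/asboolP; exists w.
by move/negbFE: (wE) => /asboolP[w' [/gZ ->]]; rewrite wE.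
Qed.

Lemma card_ord_lt n a (P : pred 'I_n) :
  (forall j, P j -> (j < a)%N) -> (#|P| <= a)%N.
Proof.
move=> Pa; rewrite cardE -(size_map val) -[leqRHS](size_iota 0).
apply: uniq_leq_size; first by rewrite map_inj_uniq ?enum_uniq//; apply: val_inj.
by move=> _ /mapP[j + ->]; rewrite mem_enum mem_iota => /Pa.
Qed.

Lemma closeness_frequency_close (R : realType) (X : metricType R) (f : X -> X)
    (x y : X) (t : R) a L :
  (forall k, (k <= L)%N -> mdist (iter (a + k) f x) (iter (a + k) f y) < t) ->
  1 - a%:R / (a + L).+1%:R <= closeness_frequency f x y t (a + L).
Proof.
move=> xy; rewrite /closeness_frequency; set P := [pred j | _].
have Pa : (#|predC P| <= a)%N.
  apply: card_ord_lt => j /=; apply: contraNltn => aj.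
  have := xy (j - a)%N; rewrite subnKC//; apply.
  by rewrite leq_subLR -ltnS.
have n0 : 0 < (a + L).+1%:R :> R by rewrite ltr0n.
rewrite -[X in X - _](@divff _ (a + L).+1%:R) ?gt_eqF// -mulrBl.
rewrite ler_pM2r ?invr_gt0// lerBlDl -natrD ler_nat.
by rewrite -{1}(card_ord (a + L).+1) -(cardC P) addnC leq_add2r.
Qed.

Lemma closeness_frequency_far (R : realType) (X : metricType R) (f : X -> X)
    (x y : X) (t : R) a L :
  (forall k, (k <= L)%N -> t <= mdist (iter (a + k) f x) (iter (a + k) f y)) ->
  closeness_frequency f x y t (a + L) <= a%:R / (a + L).+1%:R.
Proof.
move=> xy; rewrite /closeness_frequency ler_pM2r ?invr_gt0 ?ltr0n// ler_nat.
apply: card_ord_lt => j /=; apply: contraTltn => aj.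
have := xy (j - a)%N; rewrite subnKC// -leNgt; apply.
by rewrite leq_subLR -ltnS.
Qed.

Lemma closeness_frequency_ge0 (R : realType) (X : metricType R) (f : X -> X)
  (x y : X) (t : R) n : 0 <= closeness_frequency f x y t n.
Proof. by rewrite divr_ge0. Qed.

Lemma closeness_frequency_le1 (R : realType) (X : metricType R) (f : X -> X)
  (x y : X) (t : R) n : closeness_frequency f x y t n <= 1.
Proof.
rewrite ler_pdivrMr ?ltr0n// mul1r ler_nat.
by rewrite (leq_trans (max_card _))// card_ord.
Qed.

(** * Shadowing points driven by recurring targets *)

Lemma exists_invS_lt (R : realType) (e : R) : 0 < e ->
  exists N, forall i, (N <= i)%N -> i.+1%:R^-1 < e.
Proof.
move=> e0; exists (Num.truncn e^-1) => i Ni.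
rewrite -[e]invrK ltf_pV2 ?posrE ?invr_gt0 ?ltr0n//.
by rewrite -truncn_le_nat.
Qed.

Lemma exp2V_le (R : realType) i : 2 ^- i <= i.+1%:R^-1 :> R.
Proof.
by rewrite lef_pV2 ?posrE ?exprn_gt0 ?ltr0n// -natrX ler_nat ltn_expl.
Qed.

(* Step i serves the target s i, and every target recurs. The segments x i and
   the times a i, L i do not depend on w, which only chooses between the two
   points selected for each step. *)
Lemma spec_choice_family (R : realType) (X : metricType R) (f : X -> X)
    (T : countType) (P : T -> X -> X -> nat -> Prop) (t0 : T) (x0 : X) :
  compact [set: X] -> continuous f -> nonuniform_specification f ->
  exists (s : nat -> T) (a L : nat -> nat) (p q : nat -> X)
         (Z : (T -> bool) -> X),
  [/\ forall i, (i <= L i)%N,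
      forall i, (a i)%:R / (a i + L i).+1%:R <= i.+1%:R^-1 :> R,
      forall t N, (forall A, exists p q L, (A <= L)%N /\ P t p q L) ->
        exists i, [/\ (N <= i)%N, s i = t & P t (p i) (q i) (L i)]
    & forall w i k, (k <= L i)%N ->
        mdist (iter k f (if w (s i) then p i else q i))
              (iter (a i + k) f (Z w)) <= 2 * i.+1%:R^-1].
Proof.
move=> cX cf [M spec].
(* When [P t] is not realized at arbitrarily large lengths, a dummy triple [(x0, x0, A)] keeps the
   construction going. *)
have [g gP] : {g : T * nat -> X * X * nat & forall c,
    (c.2 <= (g c).2)%N /\
    ((forall A, exists p q L, (A <= L)%N /\ P c.1 p q L) ->
     P c.1 (g c).1.1 (g c).1.2 (g c).2)}.
  apply: (choice (P := fun (c : T * nat) (y : X * X * nat) => (c.2 <= y.2)%N /\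
    ((forall A, exists p q L, (A <= L)%N /\ P c.1 p q L) ->
     P c.1 y.1.1 y.1.2 y.2))) => -[t A].
  have [H|H] := pselect (forall A, exists p q L, (A <= L)%N /\ P t p q L).
    by have [p [q [L [AL PL]]]] := H A; exists (p, q, L).
  by exists (x0, x0, A).
(* The 2-adic valuation of i takes every value infinitely often; [t0] fills in for numbers that code
   no target. *)
pose s i := odflt t0 (unpickle (logn 2 i)).
(* The minimal length (i+1) a + i makes the past a fraction at most 1/(i+1) of the time elapsed at
   the end of the step. *)
pose step i a := g (s i, i.+1 * a + i)%N.
pose next i a := (a + (step i a).2 + M (a + (step i a).2).+1 (2 ^- i.+1)%R)%N.
pose a := fix a i := if i is j.+1 then next j (a j) else 0%N.
pose L i := (step i (a i)).2.
have LP i : (i.+1 * a i + i <= L i)%N by have [] := gP (s i, i.+1 * a i + i)%N.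
have [Z ZP] := choice (fun w : T -> bool => spec_shadow
  (fun i => if w (s i) then (step i (a i)).1.1 else (step i (a i)).1.2)
  (a := a) (L := L) cX cf spec erefl (fun i => leqnn _)).
exists s, a, L, (fun i => (step i (a i)).1.1), (fun i => (step i (a i)).1.2), Z.
split=> [i|i|t N Pt|w i k kL].
- exact: leq_trans (leq_addl _ _) (LP i).
- rewrite ler_pdivrMr ?ltr0n// mulrC ler_pdivlMr ?ltr0n// -natrM ler_nat.
  by have := LP i; rewrite mulnC; lia.
- pose i := (2 ^ pickle t * N.*2.+1)%N.
  have si : s i = t.
    rewrite /s /i lognM ?expn_gt0// pfactorK// logn_coprime ?addn0 ?pickleK//.
    by rewrite coprime2n /= odd_double.
  exists i; split=> //.
    by rewrite /i -[N]mul1n leq_mul// ?expn_gt0//; lia.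
  by have [_] := gP (s i, i.+1 * a i + i)%N; rewrite /L /step /= si; apply.
- apply: (le_trans (ZP w i k kL)).
  by rewrite ler_pM2l// exp2V_le.
Qed.

(** * Irregularity and DC1-scrambling inherited by shadowing *)

(** For large i the average of z at time [a i + L i] is within e/4 of that of the segment, so an
    oscillation e between segments leaves e/2 for z. *)
Lemma irregular_of_shadowing (R : realType) (X : metricType R) (f : X -> X)
    (phi : X -> R) (z : X) (x : nat -> X) (a L : nat -> nat) (r : R^nat) (e : R) :
  (forall e', 0 < e' -> exists N, forall i, (N <= i)%N -> r i < e') ->
  compact [set: X] -> continuous phi -> 0 < e ->
  (forall i, (i <= L i)%N) ->
  (forall i, (a i)%:R / (a i + L i).+1%:R <= r i) ->
  (forall i k, (k <= L i)%N ->
     mdist (iter k f (x i)) (iter (a i + k) f z) <= 2 * r i) ->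
  (forall N, exists i j, [/\ (N <= i)%N, (N <= j)%N & e <=
     `|arithmetic_mean (fun k => phi (iter k f (x i))) (L i)
       - arithmetic_mean (fun k => phi (iter k f (x j))) (L j)|]) ->
  irregular_set f phi z.
Proof.
move=> r0 cX cphi e0 iL aL xz xe.
have [K K0 phiK] := compact_bounded_fun cX cphi.
have e8 : 0 < e / 8 by rewrite divr_gt0.
have [d d0 dP] := compact_uniformly_continuous cX cphi e8.
(* Makes the contribution of the times before [a i] at most e/8; uniform continuity accounts for the
   other e/8. *)
have eK : 0 < e / (16 * K) by rewrite divr_gt0// mulr_gt0.
have [N1 N1P] := r0 _ eK.
have [N2 N2P] := r0 _ (divr_gt0 d0 (ltr0Sn R 1)).
have mean i : (N1 <= i)%N -> (N2 <= i)%N ->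
    `|arithmetic_mean (fun k => phi (iter k f z)) (a i + L i)
      - arithmetic_mean (fun k => phi (iter k f (x i))) (L i)| <= e / 4.
  move=> N1i N2i.
  have H k : (k <= L i)%N ->
      `|phi (iter k f (x i)) - phi (iter (a i + k) f z)| <= e / 8.
    move=> kL; rewrite ltW// -ball_real; apply: dP; rewrite ball_mdist.
    by have := xz i k kL; have := N2P i N2i; lra.
  apply: le_trans (arithmetic_mean_shift (fun n => phiK _) (fun n => phiK _) H) _.
  have aK : (a i)%:R / (a i + L i).+1%:R <= e / (16 * K).
    exact: le_trans (aL i) (ltW (N1P i N1i)).
  have : 2 * K * ((a i)%:R / (a i + L i).+1%:R) <= 2 * K * (e / (16 * K)).
    by rewrite ler_wpM2l// mulr_ge0// ltW.
  have -> : 2 * K * (e / (16 * K)) = e / 8 by field; rewrite gt_eqF.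
  by move: (2 * K * _) => c; lra.
apply/not_cvgnP; exists (e / 2) => [|N]; first by rewrite divr_gt0.
have [i [j [Ni Nj xij]]] := xe (maxn N (maxn N1 N2)).
move: Ni Nj; rewrite !geq_max => /and3P[Ni N1i N2i] /and3P[Nj N1j N2j].
exists (a i + L i)%N, (a j + L j)%N; split.
- exact: leq_trans (leq_trans Ni (iL i)) (leq_addl _ _).
- exact: leq_trans (leq_trans Nj (iL j)) (leq_addl _ _).
have := mean i N1i N2i; have := mean j N1j N2j; move: xij.
set u := arithmetic_mean _ (a i + L i); set v := arithmetic_mean _ (a j + L j).
set u' := arithmetic_mean _ (L i); set v' := arithmetic_mean _ (L j).
have := ler_distD u u' v'; have := ler_distD v u v'.
rewrite (distrC u u'); lra.
Qed.

(** The pigeonhole principle is applied to the pairs of codes at oscillating times, so both codes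
    recur. The constant e precedes q, so that the precision of q can be adapted to e. *)
Lemma irregular_codes (R : realType) (X : metricType R) (f : X -> X)
    (phi : X -> R) (y : X) :
  irregular_set f phi y ->
  exists2 e : R, 0 < e & forall (Q : nat) (q : X -> nat -> nat),
    (forall x n, (q x n < Q)%N) ->
    exists v1 v2 n1 n2, [/\ q y n1 = v1, q y n2 = v2,
      forall A, exists n, (A <= n)%N /\ q y n = v1,
      forall A, exists n, (A <= n)%N /\ q y n = v2
    & e <= `|arithmetic_mean (fun k => phi (iter k f y)) n1
             - arithmetic_mean (fun k => phi (iter k f y)) n2|].
Proof.
move=> /not_cvgnP[e e0 yP]; exists e => // Q q qQ.
have [n nP] := choice yP; have {nP} [m nmP] := choice nP.
have [[v1 v2] vP] :=
  infinite_pigeonhole (fun N => (Ordinal (qQ y (n N)), Ordinal (qQ y (m N)))).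
have qnm A : exists2 N, (A <= N)%N & q y (n N) = v1 /\ q y (m N) = v2.
  by have [N AN [<- <-]] := vP A; exists N.
have [N _ [qn qm]] := qnm 0.
exists v1, v2, (n N), (m N); split=> //.
- move=> A; have [B AB [qnB _]] := qnm A; exists (n B); split=> //.
  by have [nB _ _] := nmP B; apply: leq_trans nB.
- move=> A; have [B AB [_ qmB]] := qnm A; exists (m B); split=> //.
  by have [_ mB _] := nmP B; apply: leq_trans mB.
by have [] := nmP N.
Qed.

(** At time [a i + L i] the closeness frequency is decided, up to [r i], by step i alone: equal
    segments push it to 1, separated ones to 0. *)
Lemma DC1_of_shadowing (R : realType) (X : metricType R) (f : X -> X)
    (z z' : X) (x x' : nat -> X) (a L : nat -> nat) (r : R^nat) (t : R) :
  (forall e, 0 < e -> exists N, forall i, (N <= i)%N -> r i < e) ->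
  0 < t -> (forall i, (i <= L i)%N) ->
  (forall i, (a i)%:R / (a i + L i).+1%:R <= r i) ->
  (forall i k, (k <= L i)%N ->
     mdist (iter k f (x i)) (iter (a i + k) f z) <= 2 * r i) ->
  (forall i k, (k <= L i)%N ->
     mdist (iter k f (x' i)) (iter (a i + k) f z') <= 2 * r i) ->
  (forall N, exists2 i, (N <= i)%N & x i = x' i) ->
  (forall N, exists2 i, (N <= i)%N & forall k, (k <= L i)%N ->
     t <= mdist (iter k f (x i)) (iter k f (x' i))) ->
  z <> z' /\ DC1_scrambled_pair f z z'.
Proof.
move=> r0 t0 iL aL xz xz' close far.
have {}far N : exists2 i, (N <= i)%N & forall k, (k <= L i)%N ->
    t / 2 <= mdist (iter (a i + k) f z) (iter (a i + k) f z').
  (* With r i < t/8, the two shadowing errors [2 * r i] take away at most t/2. *)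
  have [N1 N1P] := r0 _ (divr_gt0 t0 (ltr0Sn R 7)).
  have [i + iP] := far (maxn N N1); rewrite geq_max => /andP[Ni /N1P it].
  exists i => // k kL; have := iP k kL; have := xz i k kL; have := xz' i k kL.
  have := metric_triangle (iter k f (x i)) (iter (a i + k) f z) (iter k f (x' i)).
  have := metric_triangle (iter (a i + k) f z) (iter (a i + k) f z') (iter k f (x' i)).
  by rewrite (metric_sym (iter (a i + k) f z') (iter k f (x' i))); lra.
have t20 : 0 < t / 2 by rewrite divr_gt0.
have late i N : (N <= i)%N -> (N <= a i + L i)%N.
  by move=> Ni; exact: leq_trans (leq_trans Ni (iL i)) (leq_addl _ _).
split; last split.
- move=> zz'; have [i _ /(_ 0%N isT)] := far 0%N.
  by rewrite zz' mdistxx leNgt t20.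
- move=> c c0; apply: limn_sup_eq1; first exact: closeness_frequency_le1.
  move=> e N e0.
  have [N1 N1P] := r0 _ (divr_gt0 c0 (ltr0Sn R 3)).
  have [N2 N2P] := r0 _ e0.
  have [i + xx'] := close (maxn N (maxn N1 N2)).
  rewrite !geq_max => /and3P[Ni /N1P N1i /N2P N2i].
  exists (a i + L i)%N; first exact: late.
  apply: (@le_trans _ _ (1 - (a i)%:R / (a i + L i).+1%:R)).
    by rewrite lerD2l lerN2 (le_trans (aL i))// ltW.
  apply: closeness_frequency_close => k kL.
  have := xz i k kL; have := xz' i k kL; rewrite xx'.
  have := metric_triangle (iter (a i + k) f z) (iter k f (x' i)) (iter (a i + k) f z').
  by rewrite (metric_sym (iter (a i + k) f z) (iter k f (x' i))); lra.
exists (t / 2) => //; apply: limn_inf_eq0.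
  exact: closeness_frequency_ge0.
move=> e N e0; have [N1 N1P] := r0 _ e0.
have [i + iP] := far (maxn N N1); rewrite geq_max => /andP[Ni /N1P ie].
exists (a i + L i)%N; first exact: late.
apply: le_trans (closeness_frequency_far iP) _.
exact: le_trans (aL i) (ltW ie).
Qed.

Theorem corollary1 (R : realType) (X : metricType R) (f : X -> X)
    (compact_X : compact [set: X])
    (two_points : exists x y : X, x <> y)
    (continuous_f : continuous f)
    (spec_f : nonuniform_specification f) :
  (exists S : set X,
     [/\ S `<=` completely_irregular_set f, ~ countable S
       & DC1_scrambled f S]) /\
  (forall phi : X -> R, continuous phi -> irregular_set f phi !=set0 ->
     exists S : set X,
       [/\ S `<=` irregular_set f phi, ~ countable S & DC1_scrambled f S]).
Proof.
suff CI : exists S : set X, [/\ S `<=` completely_irregular_set f,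
    ~ countable S & DC1_scrambled f S].
  split=> // phi cphi phi0; have [S [SCI Sunc SDC1]] := CI.
  by exists S; split=> // x /SCI; apply; split.
have [x0 _] := two_points.
have [t t0 distal] := spec_distal compact_X two_points continuous_f spec_f.
have [Q [q [qQ qP]]] := orbit_quantization f compact_X.
(* The targets: [None] brings orbits together, [inl k] separates according to bit k, and
   [inr (m, v)] realizes the code v at precision m. *)
pose P (c : option (nat + nat * nat)) (x y : X) (n : nat) := match c with
  | None => x = y
  | Some (inl _) => forall k, (k <= n)%N -> t <= mdist (iter k f x) (iter k f y)
  | Some (inr (m, v)) => x = y /\ q m x n = v
  end.
have [s [a [L [x [y [Z [iL aL sP ZP]]]]]]] :=
  @spec_choice_family _ _ f _ P None x0 compact_X continuous_f spec_f.
(* Away from the targets [inl k] the choice is constant, so all sequences w follow the same segments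
   there. *)
pose bit (w : nat -> bool) (c : option (nat + nat * nat)) :=
  if c is Some (inl k) then w k else true.
have {}ZP w := ZP (bit w).
have sep w w' : w <> w' ->
    Z (bit w) <> Z (bit w') /\ DC1_scrambled_pair f (Z (bit w)) (Z (bit w')).
  move=> ww'; have [k wk] : exists k, w k <> w' k.
    by apply: contrapT => /forallNP H; apply: ww'; apply/funext => k; apply: contrapT.
  apply: (DC1_of_shadowing (@exists_invS_lt R) t0 iL aL (ZP w) (ZP w')) => N.
    have [|i [Ni si _]] := sP None N; first by move=> A; exists x0, x0, A.
    by exists i => //; rewrite si.
  have [|i [Ni si xy]] := sP (Some (inl k)) N.
    by move=> A; have [p [p' pp']] := distal A; exists p, p', A.
  exists i => // j jL; rewrite si /=; have := xy j jL.
  by case: (w k) (w' k) wk => -[] // _; rewrite // metric_sym.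
exists (range (fun w => Z (bit w))); split.
- move=> _ [w _ <-] phi [cphi [u uirr]].
  have [e e0 codes] := irregular_codes uirr.
  (* Replacing a segment of u by one with the same code costs e/4 at each of the two times, leaving
     an oscillation of e/2. *)
  have [m mP] := qP phi (e / 4) cphi (divr_gt0 e0 (ltr0Sn R 3)).
  have [v1 [v2 [n1 [n2 [qn1 qn2 inf1 inf2 en]]]]] := codes (Q m) (q m) (qQ m).
  (* The orbit of u itself shows that the target [inr (m, v)] is realized at arbitrarily large
     lengths. *)
  have visit v N : (forall A, exists n, (A <= n)%N /\ q m u n = v) ->
      exists i, [/\ (N <= i)%N, bit w (s i) & q m (x i) (L i) = v].
    move=> vinf; have [|i [Ni si [_ xi]]] := sP (Some (inr (m, v))) N.
      by move=> A; have [n [An un]] := vinf A; exists u, u, n.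
    by exists i; split=> //; rewrite si.
  have e2 : 0 < e / 2 by rewrite divr_gt0.
  apply: (irregular_of_shadowing (@exists_invS_lt R) compact_X cphi e2 iL aL
    (ZP w)) => N.
  have [i [Ni bi xi]] := visit v1 N inf1; have [j [Nj bj xj]] := visit v2 N inf2.
  exists i, j; split=> //; rewrite /= bi bj.
  have := mP _ _ _ _ (etrans xi (esym qn1)).
  have := mP _ _ _ _ (etrans xj (esym qn2)); move: en.
  set c1 := arithmetic_mean _ n1; set c2 := arithmetic_mean _ n2.
  set b1 := arithmetic_mean _ (L i); set b2 := arithmetic_mean _ (L j).
  have := ler_distD b1 c1 c2; have := ler_distD b2 b1 c2.
  rewrite (distrC c1 b1); lra.
- by apply: uncountable_range_cantor => w w' ww'; apply: contrapT => /sep[].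
move=> _ _ [w _ <-] [w' _ <-] ZZ; apply: (proj2 (sep _ _ _)) => ww'.
by apply: ZZ; rewrite ww'.
Qed.
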